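(* Let $G=G_1\,{}_\alpha\diamond_\beta\,G_2$ be the doubly warped product of two weighted graphs with warping functions $\alpha:G_2\to(0,\infty)$, $\beta:G_1\to(0,\infty)$, and let $x\in G_1$, $p\in G_2$. If $\alpha$ is constant on the ball of radius $1$ around $p$ and $\beta$ is constant on the ball of radius $1$ around $x$ (i.e. $\alpha(q)=\alpha(p)$ for all $q\sim p$ and $\beta(y)=\beta(x)$ for all $y\sim x$), then $$\mathcal K_{G,(x,p)}(\infty)=\min\big\{\alpha^{-2}(p)\,\mathcal K_{G_1,x}(\infty),\ \beta^{-2}(x)\,\mathcal K_{G_2,p}(\infty)\big\}.$$
   Context: A weighted graph $(G,\omega,m)$ consists of a countable vertex set $G$, nonnegative edge weights $\omega_{xy}$, not necessarily symmetric but with $\omega_{xy}=s(x,y)\omega_{yx}$ for some $s(x,y)\neq0$, and a vertex measure $m:G\to(0,\infty)$. Write $x\sim y$ if $\omega_{xy}>0$; every vertex has at least one neighbour and only finitely many. For $f:G\to\mathbb R$, $\Delta f(x)=m(x)^{-1}\sum_{y\sim x}(f(y)-f(x))\omega_{xy}$; $\Gamma(u,v)=\frac12(\Delta(uv)-v\Delta u-u\Delta v)$, $\Gamma_2(u,v)=\frac12(\Delta\Gamma(u,v)-\Gamma(\Delta u,v)-\Gamma(u,\Delta v))$, $\Gamma(f)=\Gamma(f,f)$, $\Gamma_2(f)=\Gamma_2(f,f)$. $\mathcal K_{G,x}(\infty)$ is the largest $\mathcal K$ with $\Gamma_2(f)(x)\ge\mathcal K\,\Gamma(f)(x)$ for all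 $f:G\to\mathbb R$. The doubly warped product $G_1\,{}_\alpha\diamond_\beta\,G_2$ of $(G_1,\omega^{G_1},m^{G_1})$ and $(G_2,\omega^{G_2},m^{G_2})$ is the Cartesian product graph on $G_1\times G_2$ with vertex measure $m((x,p))=m^{G_1}(x)m^{G_2}(p)$ and edge weights $\omega_{((x,p),(y,q))}=\delta_{pq}\,m^{G_2}(p)\,\alpha^{-2}(p)\,\omega^{G_1}_{xy}+\delta_{xy}\,m^{G_1}(x)\,\beta^{-2}(x)\,\omega^{G_2}_{pq}$. *)

(* Defs.v *)
From mathcomp Require Import all_boot all_order all_algebra.
From mathcomp Require Import all_classical all_reals ereal.
From mathcomp Require Import ring.
Set Implicit Arguments.
Unset Strict Implicit.
Unset Printing Implicit Defensive.
Import Order.TTheory GRing.Theory Num.Theory.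
Local Open Scope classical_set_scope.
Local Open Scope ring_scope.

(* Loops (0 < weight x x) are not excluded; they do not contribute to the
   Laplacian. *)
Record wgraph (R : realType) (V : countType) := WGraph {
  weight : V -> V -> R;
  vmeas : V -> R;
  weight_ge0 : forall x y, 0 <= weight x y;
  weight_sym : forall x y, exists2 s : R, s != 0 & weight x y = s * weight y x;
  vmeas_gt0 : forall x, 0 < vmeas x;
  has_neighbour : forall x, exists y, 0 < weight x y;
  locally_finite : forall x, finite_set [set y | 0 < weight x y]
}.

Definition adj (R : realType) (V : countType) (G : wgraph R V) (x y : V) : Prop :=
  0 < weight G x y.

Section Curvature.
Variables (R : realType) (V : countType) (G : wgraph R V).

Definition laplacian (f : V -> R) (x : V) : R :=
  (vmeas G x)^-1 * \sum_(y \in [set y | adj G x y]) (f y - f x) * weight G x y.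

Definition Gamma (u v : V -> R) (x : V) : R :=
  2^-1 * (laplacian (u \* v) x - v x * laplacian u x - u x * laplacian v x).

Definition Gamma2 (u v : V -> R) (x : V) : R :=
  2^-1 * (laplacian (Gamma u v) x
          - Gamma (laplacian u) v x - Gamma u (laplacian v) x).

Definition curvature_bounds (x : V) : set R :=
  [set K | forall f : V -> R, Gamma2 f f x >= K * Gamma f f x].

(* The largest element of curvature_bounds x (see curvatureP). The supremum is
   taken in \bar R so that it carries no default value: it is +oo when the only
   neighbour of x is x itself. *)
Definition curvature (x : V) : \bar R :=
  ereal_sup (EFin @` curvature_bounds x).

Lemma Gamma_ge0 (f : V -> R) (x : V) : 0 <= Gamma f f x.
Proof.
have finN : finite_set [set y | adj G x y] := locally_finite G x.
rewrite /Gamma /laplacian !fsbig_finite //=.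
set s := finmap.enum_fset _; set m := (vmeas G x)^-1.
rewrite (_ : _ - _ - _ = m * \sum_(y <- s) (f y - f x) ^+ 2 * weight G x y).
  have m_ge0 : 0 <= m by rewrite invr_ge0 ltW ?vmeas_gt0.
  rewrite mulr_ge0 ?invr_ge0 // mulr_ge0 //.
  by apply: sumr_ge0 => y _; rewrite mulr_ge0 ?sqr_ge0 ?weight_ge0.
rewrite !mulr_sumr -!sumrB.
by apply: eq_bigr => y _; ring.
Qed.

Lemma curvatureP (x : V) (K : R) :
  curvature x = K%:E <->
  curvature_bounds x K /\ (forall L, curvature_bounds x L -> L <= K).
Proof.
split=> [supK|[bK maxK]].
  have ubK L : curvature_bounds x L -> L <= K.
    by move=> bL; rewrite -lee_fin -supK; apply: ereal_sup_ubound; exists L.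
  split=> // f; have := Gamma_ge0 f x; rewrite le_eqVlt => /predU1P[g0|g0].
    have [L bL] : curvature_bounds x !=set0.
      apply/set0P/eqP => b0.
      by move: supK; rewrite /curvature b0 image_set0 ereal_sup0.
    by have := bL f; rewrite -g0 !mulr0.
  rewrite -ler_pdivlMr // -lee_fin -supK.
  apply: ge_ereal_sup => _ [L bL <-].
  by rewrite lee_fin ler_pdivlMr //; exact: bL.
apply/eqP; rewrite eq_le; apply/andP; split.
  by apply: ge_ereal_sup => _ [L bL <-]; rewrite lee_fin maxK.
by apply: ereal_sup_ubound; exists K.
Qed.

End Curvature.

Section WarpedProduct.
Variables (R : realType) (V1 V2 : countType).
Variables (G1 : wgraph R V1) (G2 : wgraph R V2).
Variables (alpha : V2 -> R) (beta : V1 -> R).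

Definition warped_weight (u v : V1 * V2) : R :=
  (u.2 == v.2)%:R * vmeas G2 u.2 * alpha u.2 ^- 2 * weight G1 u.1 v.1
  + (u.1 == v.1)%:R * vmeas G1 u.1 * beta u.1 ^- 2 * weight G2 u.2 v.2.

Definition warped_vmeas (u : V1 * V2) : R := vmeas G1 u.1 * vmeas G2 u.2.

Hypotheses (alpha_gt0 : forall p, 0 < alpha p) (beta_gt0 : forall x, 0 < beta x).

Let weight_gt0C (V : countType) (G : wgraph R V) (x y : V) :
  (0 < weight G x y) = (0 < weight G y x).
Proof.
rewrite !lt_def !weight_ge0 !andbT; have [s s0 ->] := weight_sym G x y.
by rewrite mulf_eq0 negb_or s0.
Qed.

Lemma warped_weight_ge0 u v : 0 <= warped_weight u v.
Proof.
by rewrite addr_ge0 // !mulr_ge0 ?weight_ge0 ?invr_ge0 ?exprn_ge0 // ltW ?vmeas_gt0.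
Qed.

Lemma warped_weight_gt0 u v : (0 < warped_weight u v) =
  (u.2 == v.2) && (0 < weight G1 u.1 v.1)
  || (u.1 == v.1) && (0 < weight G2 u.2 v.2).
Proof.
have [m1 m2] := (vmeas_gt0 G1 u.1, vmeas_gt0 G2 u.2).
have [a b] := (alpha_gt0 u.2, beta_gt0 u.1).
rewrite lt_def warped_weight_ge0 andbT /warped_weight paddr_eq0; last 2 first.
- by rewrite !mulr_ge0 ?weight_ge0 ?invr_ge0 ?exprn_ge0 // ltW.
- by rewrite !mulr_ge0 ?weight_ge0 ?invr_ge0 ?exprn_ge0 // ltW.
rewrite negb_and !mulf_eq0 !negb_or !invr_eq0 !expf_eq0 /=.
rewrite (gt_eqF m1) (gt_eqF m2) (gt_eqF a) (gt_eqF b) !pnatr_eq0 !eqb0 !negbK.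
by rewrite !andbT !lt_def !weight_ge0 !andbT.
Qed.

Lemma warped_weight_sym u v :
  exists2 s : R, s != 0 & warped_weight u v = s * warped_weight v u.
Proof.
have pos : (0 < warped_weight u v) = (0 < warped_weight v u).
  rewrite !warped_weight_gt0 (eq_sym v.2) (eq_sym v.1).
  by rewrite (weight_gt0C _ v.1) (weight_gt0C _ v.2).
have [vu0|vu0] := eqVneq (warped_weight v u) 0.
  exists 1; first exact: oner_neq0.
  apply/eqP; rewrite vu0 mulr0; apply: contraFT (ltxx (0 : R)) => uv0.
  by rewrite -{2}vu0 -pos lt_def uv0 warped_weight_ge0.
exists (warped_weight u v / warped_weight v u); last by rewrite divfK.
rewrite mulf_neq0 ?invr_neq0 // gt_eqF // pos lt_def vu0.
exact: warped_weight_ge0.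
Qed.

Lemma warped_vmeas_gt0 u : 0 < warped_vmeas u.
Proof. by rewrite mulr_gt0 ?vmeas_gt0. Qed.

Lemma warped_has_neighbour u : exists v, 0 < warped_weight u v.
Proof.
by have [y xy] := has_neighbour G1 u.1; exists (y, u.2); rewrite warped_weight_gt0 eqxx xy.
Qed.

Lemma warped_locally_finite u : finite_set [set v | 0 < warped_weight u v].
Proof.
apply: (@sub_finite_set _ _ (([set u.1] `|` [set y | 0 < weight G1 u.1 y])
  `*` ([set u.2] `|` [set q | 0 < weight G2 u.2 q]))); last first.
  by apply: finite_setX; rewrite finite_setU; split => //; exact: locally_finite.
move=> v /=; rewrite warped_weight_gt0.
by case/orP => /andP[/eqP <- ?]; split; [right|left|left|right].
Qed.

Definition warped_product : wgraph R (V1 * V2)%type :=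
  WGraph warped_weight_ge0 warped_weight_sym warped_vmeas_gt0
    warped_has_neighbour warped_locally_finite.

End WarpedProduct.

(* Main.v *)
(* Write a = alpha(p)^-2, b = beta(x)^-2, and Delta_1, Delta_2 for the
   Laplacians of the two factors acting on one coordinate.  The Laplacian of
   the product is alpha^-2 Delta_1 + beta^-2 Delta_2, and local constancy makes
   both coefficients constant wherever Gamma_2 at (x, p) sees them.  Hence
     Gamma_2(f)(x,p) = a^2 Gamma_2(f(.,p))(x) + b^2 Gamma_2(f(x,.))(p) + mixed,
   where the mixed term is ab/2 times the sum over y ~ x, q ~ p, with
   nonnegative weights, of the squares of the second differences
   f(y,q) - f(y,p) - f(x,q) + f(x,p).
   Dropping it shows that the product inherits lower curvature bounds of the
   factors; it vanishes on functions of one coordinate, which gives the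
   converse. *)

Require Import Defs.
From mathcomp Require Import all_boot all_order all_algebra.
From mathcomp Require Import all_classical all_reals ereal.
From mathcomp Require Import finmap ring.
Import Order.TTheory GRing.Theory Num.Theory.
Local Open Scope ring_scope.

Section OneGraph.
Context {R : realType} {V : countType} (G : wgraph R V).

Definition neighbours (x : V) : seq V :=
  finmap.enum_fset (fset_set [set y | adj G x y]%classic).

Definition rate (x y : V) : R := (vmeas G x)^-1 * weight G x y.

Lemma rate_ge0 x y : 0 <= rate x y.
Proof. by rewrite mulr_ge0 ?weight_ge0 // invr_ge0 ltW ?vmeas_gt0. Qed.

Lemma adj_sym x y : adj G x y -> adj G y x.
Proof.
rewrite /adj !lt_def !weight_ge0 !andbT.
have [s _ ->] := weight_sym G x y.
by rewrite mulf_eq0 negb_or => /andP[].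
Qed.

Lemma neighboursP x y : y \in neighbours x -> adj G x y.
Proof.
move=> xy; have : y \in fset_set [set z | adj G x z]%classic by exact: xy.
by rewrite in_fset_set => [/set_mem|] //; exact: (locally_finite G x).
Qed.

Lemma laplacianE f x :
  laplacian G f x = \sum_(y <- neighbours x) rate x y * (f y - f x).
Proof.
rewrite /laplacian fsbig_finite; last exact: locally_finite.
by rewrite mulr_sumr; apply: eq_bigr => y _; rewrite /rate; ring.
Qed.

Lemma eq_laplacian f g x :
    (forall y, adj G x y -> f y - f x = g y - g x) ->
  laplacian G f x = laplacian G g x.
Proof.
by move=> fg; rewrite !laplacianE; apply: eq_big_seq => y /neighboursP/fg ->.
Qed.

Lemma laplacian_linear a b f g x :
  laplacian G (fun y => a * f y + b * g y) x =
  a * laplacian G f x + b * laplacian G g x.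
Proof.
rewrite !laplacianE !mulr_sumr -big_split.
by apply: eq_bigr => y _ /=; ring.
Qed.

Lemma GammaE f g x : Gamma G f g x =
  2^-1 * \sum_(y <- neighbours x) rate x y * ((f y - f x) * (g y - g x)).
Proof.
rewrite /Gamma !laplacianE !mulr_sumr -!sumrB !mulr_sumr.
by apply: eq_bigr => y _ /=; ring.
Qed.

(* As a single Laplacian at x, Gamma_2 on the product splits by one use of the
   product formula for the Laplacian. *)
Lemma Gamma2E f x : Gamma2 G f f x =
  2^-1 * laplacian G (fun y => Gamma G f f y -
    (laplacian G f y - laplacian G f x) * (f y - f x)) x.
Proof.
rewrite /Gamma2 !GammaE !laplacianE !mulr_sumr -!sumrB !mulr_sumr.
by apply: eq_bigr => y _ /=; field.
Qed.

Lemma curvature_bounds_le x K L :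
  L <= K -> curvature_bounds G x K -> curvature_bounds G x L.
Proof.
move=> LK bK f; apply: le_trans (bK f).
by rewrite ler_wpM2r ?Gamma_ge0.
Qed.

(** Moves the scaling inside the set of bounds, where the minimum of two curvatures can be read off
    from an intersection. Infinite curvature is covered as well. *)
Lemma mule_curvature x (a : R) : 0 < a ->
  (a%:E * curvature G x)%E =
  ereal_sup (EFin @` [set K | curvature_bounds G x (a^-1 * K)])%classic.
Proof.
move=> a_gt0; have a_neq0 : a != 0 by rewrite gt_eqF.
rewrite /curvature -ereal_sup_pZl //; congr ereal_sup.
apply/seteqP; split => [_ [_ [K bK <-] <-]|_ [K bK <-]].
  by exists (a * K); rewrite /= ?mulKf // EFinM.
by exists (a^-1 * K)%:E; [exists (a^-1 * K)|rewrite -EFinM mulVKf].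
Qed.

End OneGraph.

(** If both suprema exceeded that of the intersection, some [K] in [A] and [L] in [B] would too; by
    downward closure [Num.min K L] lies in both sets, a contradiction. *)
Lemma ereal_sup_setI_down (R : realType) (A B : set R) :
    (forall K L, L <= K -> A K -> A L) -> (forall K L, L <= K -> B K -> B L) ->
  ereal_sup (EFin @` (A `&` B))%classic =
  mine (ereal_sup (EFin @` A)%classic) (ereal_sup (EFin @` B)%classic).
Proof.
move=> downA downB; apply/eqP; rewrite eq_le; apply/andP; split.
  rewrite le_min.
  by apply/andP; split; apply: ereal_sup_le => _ [K [AK BK] <-]; exists K.
rewrite leNgt; apply/negP; rewrite lt_min => /andP[].
move=> /ereal_sup_gt[_ [K AK <-] ltK] /ereal_sup_gt[_ [L BL <-] ltL].
have : ((Num.min K L)%:E <= ereal_sup (EFin @` (A `&` B))%classic)%E.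
  apply: ereal_sup_ubound; exists (Num.min K L) => //; split.
    by apply: downA AK; rewrite ge_min lexx.
  by apply: downB BL; rewrite ge_min lexx orbT.
by rewrite leNgt EFin_min lt_min ltK ltL.
Qed.

Section MixedTerm.
Context {R : realType} {V1 V2 : countType}.
Variables (G1 : wgraph R V1) (G2 : wgraph R V2).
Implicit Types (f : V1 * V2 -> R) (x : V1) (p : V2).

Definition mixed_defect f x p : R :=
  \sum_(y <- neighbours G1 x) \sum_(q <- neighbours G2 p)
    rate G1 x y * rate G2 p q * (f (y, q) - f (y, p) - f (x, q) + f (x, p)) ^+ 2.

Lemma mixed_defect_ge0 f x p : 0 <= mixed_defect f x p.
Proof.
apply: sumr_ge0 => y _; apply: sumr_ge0 => q _.
by apply: mulr_ge0 (sqr_ge0 _); rewrite mulr_ge0 ?rate_ge0.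
Qed.

Lemma mixed_defect_fst (g : V1 -> R) x p : mixed_defect (g \o fst) x p = 0.
Proof. by apply: big1 => y _; apply: big1 => q _ /=; ring. Qed.

Lemma mixed_defect_snd (g : V2 -> R) x p : mixed_defect (g \o snd) x p = 0.
Proof. by apply: big1 => y _; apply: big1 => q _ /=; ring. Qed.

(** Fix a pair [(y, q)]. Let s and t be the increments of [f] from [(x, p)] to [(y, p)] and to
    [(x, q)], and D the second difference. Up to the common product of rates, the first Laplacian
    contributes t D + D^2/2 - s D and the second s D + D^2/2 - t D; the cross terms cancel and D^2
    remains. *)
Lemma mixed_laplacianE f x p :
  laplacian G1 (fun y => Gamma G2 (fun q => f (y, q)) (fun q => f (y, q)) p -
    (laplacian G2 (fun q => f (y, q)) p - laplacian G2 (fun q => f (x, q)) p) *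
      (f (y, p) - f (x, p))) x +
  laplacian G2 (fun q => Gamma G1 (fun y => f (y, q)) (fun y => f (y, q)) x -
    (laplacian G1 (fun y => f (y, q)) x - laplacian G1 (fun y => f (y, p)) x) *
      (f (x, q) - f (x, p))) p = mixed_defect f x p.
Proof.
rewrite (laplacianE G1) [X in _ + X](laplacianE G2).
under eq_bigr => y _.
  rewrite !GammaE !laplacianE !mulr_sumr -!sumrB !mulr_suml -!sumrB mulr_sumr.
  over.
under [X in _ + X]eq_bigr => q _.
  rewrite !GammaE !laplacianE !mulr_sumr -!sumrB !mulr_suml -!sumrB mulr_sumr.
  over.
rewrite [X in _ + X]exchange_big -big_split /=; apply: eq_bigr => y _.
by rewrite -big_split; apply: eq_bigr => q _ /=; field.
Qed.

End MixedTerm.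

Section WarpedProductCurvature.
Context {R : realType} {V1 V2 : countType} {G1 : wgraph R V1} {G2 : wgraph R V2}.
Context {alpha : V2 -> R} {beta : V1 -> R}.
Context {alpha_gt0 : forall q, 0 < alpha q} {beta_gt0 : forall y, 0 < beta y}.
Local Notation W := (warped_product G1 G2 alpha_gt0 beta_gt0).

Lemma warped_laplacianE f y q : laplacian W f (y, q) =
  alpha q ^- 2 * laplacian G1 (fun z => f (z, q)) y +
  beta y ^- 2 * laplacian G2 (fun r => f (y, r)) q.
Proof.
have weight0 (V : countType) (G : wgraph R V) (u v : V) :
    ~ adj G u v -> weight G u v = 0.
  by move=> /negP; rewrite /adj lt_def weight_ge0 andbT negbK => /eqP.
pose F1 v := (f v - f (y, q)) *
  ((q == v.2)%:R * vmeas G2 q * alpha q ^- 2 * weight G1 y v.1).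
pose F2 v := (f v - f (y, q)) *
  ((y == v.1)%:R * vmeas G1 y * beta y ^- 2 * weight G2 q v.2).
have W_adj v : adj W (y, q) v =
    (q == v.2) && (0 < weight G1 y v.1) || (y == v.1) && (0 < weight G2 q v.2) :> Prop.
  by rewrite /adj /= warped_weight_gt0.
rewrite {1}/laplacian (eq_fsbigr (fun v => F1 v + F2 v)); last first.
  by move=> v _; rewrite /F1 /F2 /= /warped_weight /=; ring.
rewrite fsbig_split; last exact: (locally_finite W (y, q)).
(* [F1] vanishes off the copy of the neighbours of [y] at height [q], and [F2] off the copy of those
   of [q] over [y]. The copies meet in [(y, q)] if both graphs have loops there; this is harmless,
   as [F1] and [F2] are summed separately. *)
rewrite -(@fsbig_widen _ _ _ _ [set (z, q) | z in [set z | adj G1 y z]]%classic _ F1); first last.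
- move=> [z r] [_ /= nadj]; rewrite /F1 /=.
  have [qr|] := eqVneq q r; last by rewrite !mul0r mulr0.
  rewrite weight0 ?mulr0 // => yz; apply: nadj; exists z => //.
  by rewrite qr.
- by move=> _ [z yz <-]; rewrite /= W_adj /= eqxx; apply/orP; left.
rewrite -(@fsbig_widen _ _ _ _ [set (y, r) | r in [set r | adj G2 q r]]%classic _ F2); first last.
- move=> [z r] [_ /= nadj]; rewrite /F2 /=.
  have [yz|] := eqVneq y z; last by rewrite !mul0r mulr0.
  rewrite weight0 ?mulr0 // => qr; apply: nadj; exists r => //.
  by rewrite yz.
- by move=> _ [r qr <-]; rewrite /= W_adj /= eqxx; apply/orP; right.
rewrite !fsbig_image; [|by move=> ? ? _ _ []..].
rewrite /laplacian /F1 /F2 /= /warped_vmeas /=.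
have m1 : vmeas G1 y != 0 by rewrite gt_eqF ?vmeas_gt0.
have m2 : vmeas G2 q != 0 by rewrite gt_eqF ?vmeas_gt0.
have a0 : alpha q != 0 by rewrite gt_eqF.
have b0 : beta y != 0 by rewrite gt_eqF.
rewrite !fsbig_finite; [|exact: locally_finite..].
rewrite mulrDr !mulr_sumr; congr (_ + _).
  by apply: eq_bigr => z _; rewrite eqxx mulr1n; field; rewrite m1 m2 a0.
by apply: eq_bigr => z _; rewrite eqxx mulr1n; field; rewrite m1 m2 b0.
Qed.

Lemma warped_GammaE f g y q : Gamma W f g (y, q) =
  alpha q ^- 2 * Gamma G1 (fun z => f (z, q)) (fun z => g (z, q)) y +
  beta y ^- 2 * Gamma G2 (fun r => f (y, r)) (fun r => g (y, r)) q.
Proof. by rewrite /Gamma !warped_laplacianE /=; ring. Qed.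

Context {x : V1} {p : V2}.
Hypothesis alpha_const : forall q, adj G2 q p -> alpha q = alpha p.
Hypothesis beta_const : forall y, adj G1 y x -> beta y = beta x.
Local Notation a := (alpha p ^- 2).
Local Notation b := (beta x ^- 2).

Lemma warped_Gamma2E f : Gamma2 W f f (x, p) =
  a ^+ 2 * Gamma2 G1 (fun y => f (y, p)) (fun y => f (y, p)) x +
  b ^+ 2 * Gamma2 G2 (fun q => f (x, q)) (fun q => f (x, q)) p +
  2^-1 * (a * b) * mixed_defect G1 G2 f x p.
Proof.
rewrite !Gamma2E warped_laplacianE -mixed_laplacianE.
set h1 := (X in a ^+ 2 * (_ * laplacian G1 X x)).
set h2 := (X in b ^+ 2 * (_ * laplacian G2 X p)).
set k1 := (X in laplacian G1 X x + _).
set k2 := (X in _ + laplacian G2 X p).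
(* A Laplacian at [x] reads its argument only at [x] and its neighbours, where [beta] equals
   [beta x]. There the function from [Gamma2E] for the product, restricted to the fibre through [p],
   is the combination of [h1], which gives [Gamma2] of [G1], and [k1], one half of
   [mixed_laplacianE]. *)
have lap1 h : (forall y, adj G1 x y \/ y = x -> h y = a * h1 y + b * k1 y) ->
    laplacian G1 h x = a * laplacian G1 h1 x + b * laplacian G1 k1 x.
  move=> hE; rewrite -laplacian_linear; apply: eq_laplacian => y xy.
  by rewrite !hE; [|right|left].
have lap2 h : (forall q, adj G2 p q \/ q = p -> h q = b * h2 q + a * k2 q) ->
    laplacian G2 h p = b * laplacian G2 h2 p + a * laplacian G2 k2 p.
  move=> hE; rewrite -laplacian_linear; apply: eq_laplacian => q pq.
  by rewrite !hE; [|right|left].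
rewrite lap1 => [|y xy]; last first.
  rewrite warped_GammaE !warped_laplacianE /h1 /k1.
  have -> : beta y = beta x by case: xy => [/adj_sym/beta_const|->].
  by ring.
rewrite lap2 => [|q pq]; last first.
  rewrite warped_GammaE !warped_laplacianE /h2 /k2.
  have -> : alpha q = alpha p by case: pq => [/adj_sym/alpha_const|->].
  by ring.
by ring.
Qed.

Lemma warped_curvature_bounds : curvature_bounds W (x, p) =
  ([set K | curvature_bounds G1 x (a^-1 * K)] `&`
   [set K | curvature_bounds G2 p (b^-1 * K)])%classic.
Proof.
have a_gt0 : 0 < a by rewrite invr_gt0 exprn_gt0.
have b_gt0 : 0 < b by rewrite invr_gt0 exprn_gt0.
(* A factor enters [Gamma] with c but [Gamma2] with c^2, so a bound [K] on the product is a bound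
   [c^-1 * K] on the factor. *)
have scaled (c K g g2 : R) : 0 < c -> (c^-1 * K * g <= g2) = (K * (c * g) <= c ^+ 2 * g2).
  move=> c_gt0; rewrite -[RHS](ler_pM2l (x := c ^- 2)) ?invr_gt0 ?exprn_gt0 //.
  by congr (_ <= _); field; rewrite gt_eqF.
(* A function of one coordinate is constant along the other factor, whose terms must then vanish. *)
have cst0 (V : countType) (G : wgraph R V) (c : R) v :
    Gamma G (fun=> c) (fun=> c) v = 0 /\ Gamma2 G (fun=> c) (fun=> c) v = 0.
  have G0 w : Gamma G (fun=> c) (fun=> c) w = 0.
    by rewrite GammaE big1 ?mulr0 // => y _; rewrite subrr !mulr0.
  split=> //; rewrite Gamma2E laplacianE big1 ?mulr0 // => y _.
  by rewrite !G0 !subrr !mulr0 subrr mulr0.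
apply/seteqP; split => [K bK|K [/= bK1 bK2] f].
  split=> g /=; rewrite scaled //.
    have := bK (g \o fst); rewrite warped_Gamma2E warped_GammaE mixed_defect_fst /=.
    by have [-> ->] := cst0 _ G2 (g x) p; rewrite !mulr0 !addr0.
  have := bK (g \o snd); rewrite warped_Gamma2E warped_GammaE mixed_defect_snd /=.
  by have [-> ->] := cst0 _ G1 (g p) x; rewrite !mulr0 !add0r addr0.
rewrite warped_Gamma2E warped_GammaE mulrDr -[leLHS]addr0.
apply: lerD; first by apply: lerD; rewrite -scaled.
apply: mulr_ge0 (mixed_defect_ge0 _ _ _ _ _).
by rewrite ltW // mulr_gt0 ?invr_gt0 // mulr_gt0.
Qed.

End WarpedProductCurvature.

Theorem corollary1p28 (R : realType) (V1 V2 : countType)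
    (G1 : wgraph R V1) (G2 : wgraph R V2)
    (alpha : V2 -> R) (beta : V1 -> R)
    (alpha_gt0 : forall q, 0 < alpha q) (beta_gt0 : forall y, 0 < beta y)
    (x : V1) (p : V2)
    (alpha_const : forall q, adj G2 q p -> alpha q = alpha p)
    (beta_const : forall y, adj G1 y x -> beta y = beta x) :
  curvature (warped_product G1 G2 alpha_gt0 beta_gt0) (x, p) =
  mine ((alpha p ^- 2)%:E * curvature G1 x)%E
       ((beta x ^- 2)%:E * curvature G2 p)%E.
Proof.
have a_gt0 : 0 < alpha p ^- 2 by rewrite invr_gt0 exprn_gt0.
have b_gt0 : 0 < beta x ^- 2 by rewrite invr_gt0 exprn_gt0.
rewrite !mule_curvature // {1}/curvature warped_curvature_bounds //.
by apply: ereal_sup_setI_down => K L LK /=; apply: curvature_bounds_le;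
  rewrite ler_wpM2l // invr_ge0 ltW.
Qed.
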